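(* Let $f:\mathbb{R}^d\to\mathbb{R}$ be twice-differentiable, $L$-smooth and $\mu$-strongly convex with $\mu>0$, and let $\mathbf{x}_*$ be its minimizer. Let $\mathbf{P}_*$, $\kappa_*$ be an optimal diagonal preconditioner and the corresponding optimal condition number for $f$. Let $\mathbf{x}_t\in\mathbb{R}^d$, let $\mathcal{S}_t$ be a set of diagonal positive semidefinite matrices containing $\mathbf{P}_*$, let $\gamma>0$, and let $\mathbf{P}_t\in\mathcal{S}_t$ be $\gamma$-competitive in $\mathcal{S}_t$ for the gradient $\nabla f(\mathbf{x}_t)$. If $\mathbf{P}_t$ satisfies the sufficient progress condition at $\mathbf{x}_t$, so that the step $\mathbf{x}_{t+1}=\mathbf{x}_t-\mathbf{P}_t\nabla f(\mathbf{x}_t)$ is accepted, then $$f(\mathbf{x}_{t+1})-f(\mathbf{x}_* )\le\Big(1-\frac{\gamma}{\kappa_*}\Big)\big(f(\mathbf{x}_t)-f(\mathbf{x}_* )\big).$$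
   Context: $\preceq$ is the positive semidefinite order and $\|\mathbf{x}\|_{\mathbf{A}}^2=\langle\mathbf{x},\mathbf{A}\mathbf{x}\rangle$. $L$-smooth and $\mu$-strongly convex means $\mu\mathbf{I}\preceq\nabla^2 f(\mathbf{x})\preceq L\mathbf{I}$ for all $\mathbf{x}$. Optimal diagonal preconditioner and condition number: $(\mathbf{P}_*,\kappa_* )$ attains the minimum of $\kappa$ over pairs $(\mathbf{P},\kappa)$ with $\mathbf{P}\succ0$ diagonal and $\frac1\kappa\mathbf{P}^{-1}\preceq\nabla^2 f(\mathbf{x})\preceq\mathbf{P}^{-1}$ for all $\mathbf{x}\in\mathbb{R}^d$. Competitive: $\mathbf{P}\in\mathcal{S}$ is $\gamma$-competitive in $\mathcal{S}$ for the gradient $\nabla f(\mathbf{x})$ if $\|\nabla f(\mathbf{x})\|_{\mathbf{P}}^2\ge\gamma\|\nabla f(\mathbf{x})\|_{\mathbf{Q}}^2$ for all $\mathbf{Q}\in\mathcal{S}$. Sufficient progress condition for $\mathbf{P}$ at $\mathbf{x}$: $f(\mathbf{x}-\mathbf{P}\nabla f(\mathbf{x}))\le f(\mathbf{x})-\frac12\|\nabla f(\mathbf{x})\|_{\mathbf{P}}^2$. *)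

(* Defs.v *)
From HB Require Import structures.
From mathcomp Require Import all_boot all_order all_algebra.
From mathcomp Require Import all_classical all_reals all_analysis.

Set Implicit Arguments.
Unset Strict Implicit.
Unset Printing Implicit Defensive.

Import Order.TTheory GRing.Theory Num.Theory.
Import numFieldNormedType.Exports.

Local Open Scope classical_set_scope.
Local Open Scope ring_scope.

Section Definitions.
Variables (R : realType) (d : nat).
Implicit Types (f : 'cV[R]_d -> R) (x u v : 'cV[R]_d) (A B P Q : 'M[R]_d).

Definition inner u v : R := \sum_(i < d) u i 0 * v i 0.

(* ||x||_A^2 = <x, A x> *)
Definition sqnorm A x : R := inner x (A *m x).

(* Symmetry is not part of the two definitions below: every matrix they are
   applied to is built from diagonal matrices and Hessians of twice
   (Frechet-)differentiable functions, all of which are symmetric. *)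
Definition psdmx A : Prop := forall v, 0 <= sqnorm A v.

Definition pdmx A : Prop := forall v, v != 0 -> 0 < sqnorm A v.

Definition loewner A B : Prop := psdmx (B - A).

Definition gradient f x : 'cV[R]_d :=
  \col_i 'D_(delta_mx i 0 : 'cV[R]_d) f x.

Definition hessian f x : 'M[R]_d :=
  \matrix_(i, j)
    'D_(delta_mx j 0 : 'cV[R]_d) (fun y => gradient f y i 0 : R) x.

(* The norm on 'cV[R]_d is the sup norm; differentiability (in the Frechet
   sense) does not depend on the choice of norm. *)
Definition twice_differentiable f : Prop :=
  (forall x, differentiable f x) /\ (forall x, differentiable (gradient f) x).

Definition smooth_strongly_convex (L mu : R) f : Prop :=
  forall x, loewner (mu%:M) (hessian f x) /\ loewner (hessian f x) (L%:M).

Definition minimizer f x : Prop := forall y, f x <= f y.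

(* A condition number is positive; without 0 < kappa the minimum below would
   not exist, since 1 / kappa would be allowed to be negative (or 0, as
   0^-1 = 0). *)
Definition diag_preconditioner f P (kappa : R) : Prop :=
  [/\ 0 < kappa, is_diag_mx P, pdmx P &
      forall x, loewner (kappa^-1 *: invmx P) (hessian f x) /\
                loewner (hessian f x) (invmx P)].

Definition optimal_diag_preconditioner f P (kappa : R) : Prop :=
  diag_preconditioner f P kappa /\
  forall Q (kappa' : R), diag_preconditioner f Q kappa' -> kappa <= kappa'.

Definition competitive (S : set 'M[R]_d) (gamma : R) P (g : 'cV[R]_d) : Prop :=
  S P /\ forall Q, S Q -> gamma * sqnorm Q g <= sqnorm P g.

Definition sufficient_progress f P x : Prop :=
  f (x - P *m gradient f x) <= f x - 2^-1 * sqnorm P (gradient f x).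

End Definitions.

(* Main.v *)
Require Import Defs.
From HB Require Import structures.
From mathcomp Require Import all_boot all_order all_algebra.
From mathcomp Require Import all_classical all_reals all_analysis.
From mathcomp Require Import ring lra.

Set Implicit Arguments.
Unset Strict Implicit.
Unset Printing Implicit Defensive.

Import Order.TTheory GRing.Theory Num.Theory.
Import numFieldNormedType.Exports.

Local Open Scope classical_set_scope.
Local Open Scope ring_scope.

(** Write [g] for the gradient of [f] at [x], and [(P, kappa)] for a diagonal
    preconditioner of [f].

    The lower Loewner bound on the Hessian says that [f] is strongly convex in
    the norm of [P^-1], with modulus [1 / kappa].  Integrating it twice along
    the segment from [x] to [y = x + v] gives
    [f y >= f x + <g, v> + (1 / (2 kappa)) ||v||^2_{P^-1}]
    ([second_order_lower_bound]).  Completing the square in [v], the right-hand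
    side is at least [f x - (kappa / 2) ||g||^2_P] whatever [v] is
    ([preconditioned_young]).  At [y = xstar] this is the
    Polyak-Lojasiewicz inequality
    [||g||^2_P >= (2 / kappa) (f x - f xstar)]
    in the preconditioned norm ([preconditioned_PL]).

    An accepted step decreases [f] by at least half of [||g||^2_{Pt}].
    Competitiveness against [Pstar] bounds this below by
    [(gamma / 2) ||g||^2_{Pstar}], and the Polyak-Lojasiewicz inequality for
    [Pstar] bounds that below by [(gamma / kappastar) (f xt - f xstar)]. *)

(** * Quadratic forms *)

Lemma innerE (R : realType) d (u v : 'cV[R]_d) :
  inner u v = (u^T *m v) 0 0.
Proof. by rewrite mxE; apply: eq_bigr => i _; rewrite mxE. Qed.

Lemma innerC (R : realType) d (u v : 'cV[R]_d) : inner u v = inner v u.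
Proof. by apply: eq_bigr => i _; rewrite mulrC. Qed.

Lemma innerDr (R : realType) d (u v w : 'cV[R]_d) :
  inner u (v + w) = inner u v + inner u w.
Proof. by rewrite !innerE mulmxDr mxE. Qed.

Lemma innerZr (R : realType) d (a : R) (u v : 'cV[R]_d) :
  inner u (a *: v) = a * inner u v.
Proof. by rewrite !innerE -scalemxAr mxE. Qed.

Lemma innerDl (R : realType) d (u v w : 'cV[R]_d) :
  inner (u + v) w = inner u w + inner v w.
Proof. by rewrite !(innerC _ w) innerDr. Qed.

Lemma innerZl (R : realType) d (a : R) (u v : 'cV[R]_d) :
  inner (a *: u) v = a * inner u v.
Proof. by rewrite !(innerC _ v) innerZr. Qed.

Lemma inner_mulmxr (R : realType) d (A : 'M[R]_d) (u v : 'cV[R]_d) :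
  inner u (A *m v) = inner (A^T *m u) v.
Proof. by rewrite !innerE trmx_mul trmxK mulmxA. Qed.

Lemma sqnormE (R : realType) d (A : 'M[R]_d) (v : 'cV[R]_d) :
  sqnorm A v = (v^T *m A *m v) 0 0.
Proof. by rewrite /sqnorm innerE mulmxA. Qed.

Lemma sqnormZ (R : realType) d (a : R) (A : 'M[R]_d) (v : 'cV[R]_d) :
  sqnorm (a *: A) v = a * sqnorm A v.
Proof. by rewrite !sqnormE -scalemxAr -scalemxAl mxE. Qed.

Lemma loewner_sqnorm_le (R : realType) d (A B : 'M[R]_d) (v : 'cV[R]_d) :
  loewner A B -> sqnorm A v <= sqnorm B v.
Proof.
by move=> /(_ v); rewrite !sqnormE mulmxBr mulmxBl !mxE subr_ge0.
Qed.

Lemma pdmx_psdmx (R : realType) d (A : 'M[R]_d) : pdmx A -> psdmx A.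
Proof.
move=> pdA v; have [->|/pdA/ltW//] := eqVneq v 0.
by rewrite sqnormE mulmx0 mxE.
Qed.

(** A row vector [u] with [u A = 0] has [<u, A u> = 0], so it vanishes. *)
Lemma pdmx_unit (R : realType) d (A : 'M[R]_d) : pdmx A -> A \in unitmx.
Proof.
move=> pdA; rewrite -row_free_unit -kermx_eq0; apply/eqP/row_matrixP => i.
rewrite row0; set u := row i _.
have uA0 : u *m A = 0 by apply/eqP; rewrite -sub_kermx row_sub.
apply/eqP; rewrite -trmx_eq0; apply/negP => /negP /pdA.
by rewrite sqnormE trmxK uA0 mul0mx mxE ltxx.
Qed.

Lemma is_diag_mx_tr (R : realType) d (A : 'M[R]_d) : is_diag_mx A -> A^T = A.
Proof. by move=> /diag_mxP[D ->]; rewrite tr_diag_mx. Qed.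

(** Completing the square: with [w = P^-1 v], the difference of the two
    sides is [1 / (2 kappa)] times the squared [P]-norm of [kappa g + w]. *)
Lemma preconditioned_young (R : realType) d (P : 'M[R]_d) (kappa : R)
    (g v : 'cV[R]_d) :
  0 < kappa -> P^T = P -> pdmx P ->
  - (kappa / 2) * sqnorm P g <=
    inner g v + 2^-1 * sqnorm (kappa^-1 *: invmx P) v.
Proof.
move=> k0 Psym pdP.
set w := invmx P *m v.
have vE : v = P *m w by rewrite mulKVmx// pdmx_unit.
have wg : inner w (P *m g) = inner g v.
  by rewrite inner_mulmxr Psym innerC vE.
have := pdmx_psdmx pdP (kappa *: g + w).
rewrite sqnormZ /sqnorm -/w mulmxDr -scalemxAr -vE.
rewrite !(innerDl, innerDr, innerZl, innerZr) wg (innerC w).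
set a := inner g v; set b := inner v w; set c := inner g _ => H.
suff : 0 <= kappa / 2 * c + (a + 2^-1 * (kappa^-1 * b)) by lra.
have -> : kappa / 2 * c + (a + 2^-1 * (kappa^-1 * b)) =
    (2 * kappa)^-1 * (kappa * (kappa * c) + kappa * a + (kappa * a + b)).
  by field; rewrite gt_eqF.
rewrite mulr_ge0//; first by rewrite invr_ge0 mulr_ge0// ltW.
by move: H; lra.
Qed.

(** * Derivatives along a line *)

Lemma derive_coordE (R : realType) d (h : 'cV[R]_d -> R) (x v : 'cV[R]_d) :
  differentiable h x ->
  'D_v h x = \sum_(i < d) v i 0 * 'D_(delta_mx i 0 : 'cV[R]_d) h x.
Proof.
move=> dh; rewrite deriveE// [in LHS](matrix_sum_delta v) linear_sum /=.
by apply: eq_bigr => i _; rewrite big_ord1 linearZ/= deriveE.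
Qed.

(** The difference quotients of [t |-> h (x + t v)] at [t] are those of [h] at
    [x + t v] in the direction [v]. *)
Lemma is_derive_line (R : realType) d (h : 'cV[R]_d -> R) (x v : 'cV[R]_d)
    (t : R) :
  differentiable h (x + t *: v) ->
  is_derive t 1 (fun s : R => h (x + s *: v)) ('D_v h (x + t *: v)).
Proof.
move=> dh.
have E : (fun s : R => s^-1 *: (((fun s : R => h (x + s *: v)) \o shift t)
             (s *: 1) - h (x + t *: v))) =
         (fun s : R => s^-1 *: ((h \o shift (x + t *: v)) (s *: v)
             - h (x + t *: v))).
  apply/funext => s /=; congr (_ *: (h _ - _)).
  by rewrite -[s *: 1]/(s * 1) mulr1 scalerDl addrCA.
split; last by rewrite /derive E.
by rewrite /derivable E; exact: diff_derivable.
Qed.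

Lemma is_derive_line_gradient (R : realType) d (f : 'cV[R]_d -> R)
    (x v : 'cV[R]_d) (t : R) :
  twice_differentiable f ->
  is_derive t 1 (fun s : R => f (x + s *: v))
    (inner (gradient f (x + t *: v)) v).
Proof.
move=> [df _].
have -> : inner (gradient f (x + t *: v)) v = 'D_v f (x + t *: v).
  by rewrite derive_coordE//; apply: eq_bigr => i _; rewrite mxE mulrC.
exact: is_derive_line.
Qed.

(** Coordinate by coordinate: [t |-> <gradient f (x + t v), v>] is the sum over
    [i] of [v_i] times the restriction to the line of the [i]-th partial
    derivative, which is differentiable because the gradient is. *)
Lemma is_derive_line_hessian (R : realType) d (f : 'cV[R]_d -> R)
    (x v : 'cV[R]_d) (t : R) :
  twice_differentiable f ->
  is_derive t 1 (fun s : R => inner (gradient f (x + s *: v)) v)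
    (sqnorm (hessian f (x + t *: v)) v).
Proof.
move=> [_ dg].
have dgz i z : differentiable (fun y => gradient f y i 0 : R) z.
  exact: (differentiable_comp (dg z) (differentiable_coord _ _ _)).
have dgi i : is_derive t 1 (fun s : R => gradient f (x + s *: v) i 0)
    ('D_v (fun y => gradient f y i 0 : R) (x + t *: v)).
  exact: (is_derive_line (dgz i _)).
have := is_derive_sum (fun i => is_deriveZ (v i 0) (dgi i)).
congr (is_derive _ _ _ _).
  by apply/funext => s; rewrite fct_sumE innerC.
apply: eq_bigr => i _; rewrite derive_coordE// mxE; congr (_ * _).
by apply: eq_bigr => j _; rewrite mxE mulrC.
Qed.

(** * Second-order lower bounds *)

(** The mean value theorem for [phi s - c / 2 s^2 - dphi 0 s] on [[0, 1]], whose
    derivative is nonnegative by the mean value theorem for [dphi]. *)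
Lemma taylor2_lower (R : realType) (phi dphi ddphi : R -> R) (c : R) :
  (forall t : R, is_derive t 1 phi (dphi t)) ->
  (forall t : R, is_derive t 1 dphi (ddphi t)) ->
  (forall t, c <= ddphi t) ->
  phi 0 + dphi 0 + 2^-1 * c <= phi 1.
Proof.
move=> d1 d2 hc.
have dpsi (t : R) : is_derive t 1
    (fun s => phi s - (2^-1 * c * s ^+ 2 + dphi 0 * s))
    (dphi t - (c * t + dphi 0)).
  have := d1 t => ?.
  apply: is_derive_eq.
  by rewrite /GRing.scale /=; field.
have [|s] := MVT ltr01 (fun t _ => dpsi t).
  by apply: derivable_within_continuous => t _; apply: ex_derive.
rewrite in_itv /= => /andP[s0 s1] E.
have [|r _ E2] := MVT s0 (fun t _ => d2 t).
  by apply: derivable_within_continuous => t _; apply: ex_derive.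
have : c * s <= ddphi r * s by rewrite ler_pM2r.
move: E E2; rewrite expr1n expr0n /= => E E2.
lra.
Qed.

Lemma second_order_lower_bound (R : realType) d (f : 'cV[R]_d -> R)
    (A : 'M[R]_d) (x v : 'cV[R]_d) :
  twice_differentiable f -> (forall z, loewner A (hessian f z)) ->
  f x + inner (gradient f x) v + 2^-1 * sqnorm A v <= f (x + v).
Proof.
move=> df hA.
have := taylor2_lower (fun t => is_derive_line_gradient x v t df)
  (fun t => is_derive_line_hessian x v t df)
  (fun t => loewner_sqnorm_le v (hA (x + t *: v))).
by rewrite !scale0r !addr0 scale1r.
Qed.

(** The quadratic lower bound at [x] holds at every [y], and its minimum over
    [y] does not depend on [y].  When [y] is a minimizer of [f] this is the
    Polyak-Lojasiewicz inequality in the norm of [P]. *)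
Lemma preconditioned_PL (R : realType) d (f : 'cV[R]_d -> R) (P : 'M[R]_d)
    (kappa : R) (x y : 'cV[R]_d) :
  twice_differentiable f -> diag_preconditioner f P kappa ->
  f x - f y <= kappa / 2 * sqnorm P (gradient f x).
Proof.
move=> df [k0 /is_diag_mx_tr Psym pdP hH].
have := second_order_lower_bound x (y - x) df (fun z => (hH z).1).
have := preconditioned_young (gradient f x) (y - x) k0 Psym pdP.
rewrite [x + _]addrC subrK; lra.
Qed.

Theorem proposition3p2 (R : realType) (d : nat) (f : 'cV[R]_d -> R) (L mu : R)
    (xstar : 'cV[R]_d) (Pstar : 'M[R]_d) (kappastar : R)
    (xt xt1 : 'cV[R]_d) (St : set 'M[R]_d) (gamma : R) (Pt : 'M[R]_d)
    (hf2 : twice_differentiable f)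
    (hmu : 0 < mu)
    (hf : smooth_strongly_convex L mu f)
    (hxstar : minimizer f xstar)
    (hopt : optimal_diag_preconditioner f Pstar kappastar)
    (hSt : forall P, St P -> is_diag_mx P /\ psdmx P)
    (hStP : St Pstar)
    (hgamma : 0 < gamma)
    (hPt : competitive St gamma Pt (gradient f xt))
    (hprogress : sufficient_progress f Pt xt)
    (hxt1 : xt1 = xt - Pt *m gradient f xt) :
  f xt1 - f xstar <= (1 - gamma / kappastar) * (f xt - f xstar).
Proof.
have [hpre _] := hopt; have [k0 _ _ _] := hpre.
have PL := preconditioned_PL xt xstar hf2 hpre.
have comp := hPt.2 _ hStP.
move: hprogress; rewrite /sufficient_progress -hxt1 => prog.
have PLk : (f xt - f xstar) / kappastar <=
    2^-1 * sqnorm Pstar (gradient f xt) by rewrite ler_pdivrMr//; lra.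
have := ler_wpM2l (ltW hgamma) PLk.
lra.
Qed.
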